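(* Let $\lambda > 0$, let $y \in \mathbb{R}^2$, and let $H$ be a real $2 \times 2$ matrix such that $H^{\mathsf T} H = Q^{\mathsf T} \Gamma Q$, where $$Q = \frac{1}{\sqrt 2}\begin{bmatrix} 1 & 1 \\ 1 & -1 \end{bmatrix}, \qquad \Gamma = \begin{bmatrix} \gamma_1 & 0 \\ 0 & \gamma_2 \end{bmatrix}$$ (so $\gamma_1, \gamma_2 \ge 0$ are the eigenvalues of $H^{\mathsf T}H$). Let $\psi(\,\cdot\,; a)\colon \mathbb{R}^2 \to \mathbb{R}$ be the bivariate penalty defined in the context from a univariate penalty $\phi$ satisfying properties P1–P10. If $a = (a_1,a_2)$ satisfies $0 \le a_i \le \gamma_i/\lambda$ for $i = 1,2$, then the function $f(\,\cdot\,; a)\colon \mathbb{R}^2 \to \mathbb{R}$, $$f(x; a) = \tfrac12 \|y - Hx\|_2^2 + \lambda\, \psi(x; a),$$ is convex.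
   Context: Univariate penalty: a family of functions $\phi(\,\cdot\,;a)\colon \mathbb{R}\to\mathbb{R}$, indexed by $a \ge 0$, with the following properties for all $a\ge 0$ (derivatives $\phi',\phi''$ are with respect to $t$; $0^+$ denotes the right-hand limit at $0$): P1) $\phi(\,\cdot\,;a)$ is continuous on $\mathbb{R}$; P2) $\phi(\,\cdot\,;a)$ is twice continuously differentiable, increasing and concave on $\mathbb{R}_+ = (0,\infty)$; P3) $\phi(0;a)=0$; P4) $\phi(t;0)=|t|$; P5) $\phi(-t;a)=\phi(t;a)$; P6) $\phi'(0^+;a)=1$; P7) $\phi''(0^+;a)=-a$; P8) $\phi''(t;a)\ge -a$ for all $t\ne 0$; P9) for each $t$, $\phi(t;a)$ is decreasing (non-strictly) and convex in $a$; P10) $\phi(t;a) = (b/a)\,\phi(at/b;b)$ for all $a,b>0$. Define $s(t;a)=\phi(t;a)-|t|$. Bivariate function $S$: let $a=(a_1,a_2)$ with $a_i\ge 0$. If at least one $a_i$ is non-zero, put $\alpha = \frac{a_1+a_2}{2}$, $r=\frac{a_1-a_2}{a_1+a_2}$, and define $S(\,\cdot\,;a)\colon\mathbb{R}^2\to\mathbb{R}$ by $$S(x;a)=\begin{cases} s(x_1+rx_2;\alpha)+(1-r)\,s(x_2;a_1), & x\in A_1\\ s(rx_1+x_2;\alpha)+(1-r)\,s(x_1;a_1), & x\in A_2\\ s(rx_1+x_2;\alpha)+(1+r)\,s(x_1;a_2), & x\in A_3\\ s(x_1+rx_2;\alpha)+(1+r)\,s(x_2;a_2), & x\in A_4\end{cases}$$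 where $A_1=\{x: x_2(x_1-x_2)\ge 0\}$, $A_2=\{x: x_1(x_1-x_2)\le 0\}$, $A_3=\{x: x_1(x_1+x_2)\le 0\}$, $A_4=\{x: x_2(x_1+x_2)\le 0\}$ (the formulas agree on overlaps). If $a_1=a_2=0$, $S(x;0)=0$. Bivariate penalty: $\psi(x;a)=S(x;a)+\|x\|_1$, where $\|x\|_1=|x_1|+|x_2|$. *)

(* Defs.v *)
From HB Require Import structures.
From mathcomp Require Import all_boot all_order all_algebra.
From mathcomp Require Import all_classical all_reals all_analysis.

Set Implicit Arguments.
Unset Strict Implicit.
Unset Printing Implicit Defensive.

Import Order.TTheory GRing.Theory Num.Theory.
Import numFieldNormedType.Exports.

Local Open Scope classical_set_scope.
Local Open Scope ring_scope.

(* [phi a t] stands for phi(t; a); the values of [phi] at a < 0 are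
   unconstrained and never used for a nonnegative parameter vector. *)
Record univariate_penalty (R : realType) (phi : R -> R -> R) : Prop :=
  UnivariatePenalty {
  penalty_continuous : forall a : R, 0 <= a -> continuous (phi a);
  penalty_derivable : forall a : R, 0 <= a ->
    forall t : R, 0 < t -> derivable (phi a) t 1;
  penalty_derivable2 : forall a : R, 0 <= a ->
    forall t : R, 0 < t -> derivable (phi a)^`()%classic t 1;
  penalty_continuous2 : forall a : R, 0 <= a ->
    forall t : R, 0 < t -> {for t, continuous (phi a)^`(2)%classic};
  (* "increasing" is understood non-strictly *)
  penalty_increasing : forall a : R, 0 <= a ->
    {in `]0, +oo[ &, nondecreasing_fun (phi a)};
  penalty_concave : forall a : R, 0 <= a ->
    @convex_function R R^o `]0, +oo[%classic (fun t => - phi a t);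
  penalty_at0 : forall a : R, 0 <= a -> phi a 0 = 0;
  penalty_param0 : forall t : R, phi 0 t = `|t|;
  penalty_even : forall a : R, 0 <= a -> forall t : R, phi a (- t) = phi a t;
  penalty_deriv_0p : forall a : R, 0 <= a ->
    (phi a)^`()%classic t @[t --> 0^'+] --> (1 : R);
  penalty_deriv2_0p : forall a : R, 0 <= a ->
    (phi a)^`(2)%classic t @[t --> 0^'+] --> - a;
  penalty_deriv2_ge : forall a : R, 0 <= a ->
    forall t : R, t != 0 -> - a <= (phi a)^`(2)%classic t;
  penalty_param_decreasing : forall t : R,
    {in `[0, +oo[ &, nonincreasing_fun (phi ^~ t)};
  penalty_param_convex : forall t : R,
    @convex_function R R^o `[0, +oo[%classic (phi ^~ t);
  penalty_scale : forall a b : R, 0 < a -> 0 < b ->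
    forall t : R, phi a t = b / a * phi b (a * t / b)
}.

Section BivariatePenalty.
Variables (R : realType) (phi : R -> R -> R).

Definition penalty_s (a t : R) : R := phi a t - `|t|.

Definition regionA1 (x1 x2 : R) : bool := 0 <= x2 * (x1 - x2).
Definition regionA2 (x1 x2 : R) : bool := x1 * (x1 - x2) <= 0.
Definition regionA3 (x1 x2 : R) : bool := x1 * (x1 + x2) <= 0.
Definition regionA4 (x1 x2 : R) : bool := x2 * (x1 + x2) <= 0.

(* The four regions cover the plane, so the last branch is never reached; for
   an even, scale-covariant penalty vanishing at 0 the formulas agree on
   overlaps, so the order of the tests is immaterial. *)
Definition bivariate_S (a : 'rV[R]_2) (x : 'cV[R]_2) : R :=
  let a1 := a 0 0 in let a2 := a 0 1 in
  let x1 := x 0 0 in let x2 := x 1 0 in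
  let alpha := (a1 + a2) / 2 in
  let r := (a1 - a2) / (a1 + a2) in
  let s t c := penalty_s c t in
  if a == 0 then 0
  else if regionA1 x1 x2 then s (x1 + r * x2) alpha + (1 - r) * s x2 a1
  else if regionA2 x1 x2 then s (r * x1 + x2) alpha + (1 - r) * s x1 a1
  else if regionA3 x1 x2 then s (r * x1 + x2) alpha + (1 + r) * s x1 a2
  else if regionA4 x1 x2 then s (x1 + r * x2) alpha + (1 + r) * s x2 a2
  else 0.

Definition l1_norm (n : nat) (x : 'cV[R]_n) : R := \sum_(i < n) `|x i 0|.

(* The library norm on matrices is the sup norm. *)
Definition l2_norm (n : nat) (x : 'cV[R]_n) : R :=
  Num.sqrt (\sum_(i < n) x i 0 ^+ 2).

Definition bivariate_penalty (a : 'rV[R]_2) (x : 'cV[R]_2) : R :=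
  bivariate_S a x + l1_norm x.

Definition objective (H : 'M[R]_2) (y : 'cV[R]_2) (lambda : R)
    (a : 'rV[R]_2) (x : 'cV[R]_2) : R :=
  2^-1 * l2_norm (y - H *m x) ^+ 2 + lambda * bivariate_penalty a x.

End BivariatePenalty.

(* [[1, 1], [1, -1]] / sqrt 2 *)
Definition Qmx (R : realType) : 'M[R]_2 :=
  (Num.sqrt 2)^-1 *: \matrix_(i < 2, j < 2) (-1) ^+ (i * j).

(* Main.v *)
Require Import Defs.
From mathcomp Require Import all_boot all_order all_algebra.
From mathcomp Require Import all_classical all_reals all_analysis.
From mathcomp Require Import ring lra.

Import Order.TTheory GRing.Theory Num.Theory.
Import numFieldNormedType.Exports.

(** Put [g_b(t) = phi(t; b) - |t| + (b/2) t^2].  By P2 and P8 it has a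
nondecreasing derivative on the positive half-line, by P6 this derivative
vanishes at [0+], and by P5 [g_b] is even; so [g_b] is convex, nonnegative
and zero at the origin ([profile_tangent], [profile_ge0]).

The hypothesis on [H] gives
[|Hd|^2 = gamma_1/2 (d_1 + d_2)^2 + gamma_2/2 (d_1 - d_2)^2], so half the
residual can give away
[lambda (a_1/4 (x_1 + x_2)^2 + a_2/4 (x_1 - x_2)^2)] and remain convex
([quadratic_convex]); this is where [a_i <= gamma_i / lambda] enters.
Added to [lambda S], this quadratic completes every [s(.; b)] that occurs in
[S] to the corresponding [g_b] ([bivariate_S_glue]).  What is left besides
the convex l1 norm is the function [P] given, with [M] and [N] the larger and
the smaller of [|x_1|, |x_2|], by
[g_alpha(M + r N) + (1 - r) g_(a_1)(N)] if [x_1 x_2 >= 0], and by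
[g_alpha(M - r N) + (1 + r) g_(a_2)(N)] if [x_1 x_2 <= 0].

Each formula is convex on its own sector, and the point is that no concave
crease appears where sectors meet.  This is shown by exhibiting an affine
minorant of [P] touching it at a given point [p].  The symmetries of [P]
(exchange of coordinates, global sign, and [x_2 -> - x_2] which exchanges
[a_1] and [a_2]) reduce to [0 <= p_2 <= p_1].  There the minorant comes from
a subgradient [m] of [g_alpha] at [p_1 + r p_2] and a subgradient [n] of
[g_(a_1)] at [p_2], and it stays below [P] on the seven other sectors as soon
as [0 <= n <= m] ([octant_glue_supported_sector]).  This order of the slopes
follows from P10: as [a_1 = (1 + r) alpha], it makes the slope of [g_(a_1)] at
[p_2] equal to that of [g_alpha] at [(1 + r) p_2 <= p_1 + r p_2]
([profile_steeper]). *)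

Set Implicit Arguments.
Unset Strict Implicit.
Unset Printing Implicit Defensive.

Local Open Scope classical_set_scope.
Local Open Scope ring_scope.

(** * The penalty made convex in one variable *)

Section Profile.
Variables (R : realType) (phi : R -> R -> R).
Hypothesis phiP : univariate_penalty phi.

Definition profile (a t : R) : R := penalty_s phi a t + a / 2 * t ^+ 2.
Definition dprofile (a t : R) : R :=
  if 0 < t then (phi a)^`()%classic t + a * t - 1 else 0.

Lemma profile0 a : 0 <= a -> profile a 0 = 0.
Proof.
move=> a0; rewrite /profile /penalty_s (penalty_at0 phiP)// normr0.
by rewrite expr0n/= mulr0 subrr addr0.
Qed.

Lemma profile_abs a t : 0 <= a -> profile a `|t| = profile a t.
Proof.
move=> a0; rewrite /profile /penalty_s normr_id real_normK ?num_real//.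
by have [_|_] := ger0P t; rewrite ?(penalty_even phiP).
Qed.

Lemma profile_param0 t : profile 0 t = 0.
Proof. by rewrite /profile /penalty_s (penalty_param0 phiP) subrr !mul0r addr0. Qed.

Lemma profile_scale a b t : 0 < a -> 0 < b ->
  profile a t = b / a * profile b (a / b * t).
Proof.
move=> a0 b0; rewrite /profile /penalty_s (penalty_scale phiP a0 b0).
rewrite normrM ger0_norm ?divr_ge0 ?ltW// [a * t / b]mulrAC.
by field; rewrite !gt_eqF.
Qed.

(** On the positive half-line the profile is this expression without absolute
value, which is differentiable with the derivative displayed; [dprofile]
extends that derivative by its limit at [0]. *)
Lemma is_derive_profile (a t : R) : 0 <= a -> 0 < t ->
  is_derive t 1 (fun t => phi a t - t + a / 2 * t ^+ 2)
    ((phi a)^`()%classic t + a * t - 1).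
Proof.
move=> a0 t0.
have := penalty_derivable phiP a0 t0 => /derivableP dphi.
rewrite derive1E.
apply: is_derive_eq.
rewrite /GRing.scale/=; lra.
Qed.

Lemma is_derive_dprofile (a t : R) : 0 <= a -> 0 < t ->
  is_derive t 1 (fun t => (phi a)^`()%classic t + a * t - 1)
    ((phi a)^`(2)%classic t + a).
Proof.
move=> a0 t0.
have := penalty_derivable2 phiP a0 t0 => /derivableP dphi.
rewrite derive1nS derive1E.
apply: is_derive_eq.
rewrite /GRing.scale/=; lra.
Qed.

(** The derivative in [t] of [phi' + a * t - 1] is [phi'' + a], nonnegative
by P8. *)
Lemma derive1_profile_le (a : R) : 0 <= a ->
  forall u v : R, 0 < u -> u <= v ->
  (phi a)^`()%classic u + a * u - 1 <= (phi a)^`()%classic v + a * v - 1.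
Proof.
move=> a0 u v u0 uv.
have pos w : w \in `[u, v] -> 0 < w.
  by rewrite in_itv/= => /andP[uw _]; exact: lt_le_trans uw.
have dw w : w \in `[u, v] -> is_derive w 1 _ _ :=
  fun h => @is_derive_dprofile a w a0 (pos w h).
apply: (@ger0_derive1_le_cc _ (fun t => (phi a)^`()%classic t + a * t - 1) u v) => //.
- by move=> w /subset_itv_oo_cc wI; have [] := dw w wI.
- move=> w /subset_itv_oo_cc wI; rewrite derive1E.
  have [_ ->] := dw w wI.
  have := penalty_deriv2_ge phiP a0 (lt0r_neq0 (pos w wI)); lra.
- by apply: derivable_within_continuous => w wI; have [] := dw w wI.
- by rewrite in_itv/= lexx.
- by rewrite in_itv/= uv lexx.
Qed.

(** By monotonicity the slope at [t] bounds the slopes at smaller points, whose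
limit at [0+] is [1 - 1 = 0] by P6. *)
Lemma dprofile_ge0 a t : 0 <= a -> 0 <= dprofile a t.
Proof.
move=> a0; rewrite /dprofile; case: ifP => // t0.
suff : 1 <= (phi a)^`()%classic t + a * t by lra.
have := penalty_deriv_0p phiP a0.
move/cvgr_to_le; apply.
near=> e.
have e0 : 0 < e by near: e; exact: nbhs_right_gt.
have et : e <= t by near: e; exact: nbhs_right_le.
have : (phi a)^`()%classic e + a * e - 1 <= (phi a)^`()%classic t + a * t - 1.
  exact: derive1_profile_le.
have := mulr_ge0 a0 (ltW e0); lra.
Unshelve. all: by end_near. Qed.

Lemma dprofile_le a u v : 0 <= a -> u <= v -> dprofile a u <= dprofile a v.
Proof.
move=> a0 uv; rewrite {1}/dprofile; case: ifPn => [u0|_]; last exact: dprofile_ge0.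
have v0 := lt_le_trans u0 uv; rewrite /dprofile v0.
exact: derive1_profile_le.
Qed.

(** Convexity of the even profile, in the form that the plane needs: between
[u] and [`|t|] the mean value theorem compares the increment with the slope
at [u], and the slope is nondecreasing. *)
Lemma profile_tangent a u t : 0 <= a -> 0 <= u ->
  profile a u + dprofile a u * (`|t| - u) <= profile a t.
Proof.
move=> a0 u0; rewrite -(profile_abs t)//; move: `|t| (normr_ge0 t) => {}t t0.
have E w : 0 <= w -> profile a w = phi a w - w + a / 2 * w ^+ 2.
  by move=> w0; rewrite /profile /penalty_s ger0_norm.
have step v w : 0 <= v -> v <= w ->
    exists2 c, v <= c <= w & profile a w - profile a v = dprofile a c * (w - v).
  move=> v0 vw; rewrite !E ?(le_trans v0)//.
  have [| |c cI ->] := @MVT_segment _ (fun t => phi a t - t + a / 2 * t ^+ 2)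
    (dprofile a) v w vw.
  - move=> c; rewrite in_itv/= => /andP[vc _].
    have c0 : 0 < c by apply: le_lt_trans vc.
    by rewrite /dprofile c0; exact: is_derive_profile.
  - apply: continuous_subspaceT; move=> c; have cP := penalty_continuous phiP.
    apply: cvgD; first by apply: cvgB; [exact: cP|exact: cvg_id].
    by apply: cvgM; [exact: cvg_cst|exact: exprn_continuous].
  by exists c; rewrite // -in_itv.
have [tu|/ltW ut] := leP t u.
  have [c /andP[tc cu] e] := step t u t0 tu.
  have := ler_wpM2r (_ : 0 <= u - t) (dprofile_le a0 cu).
  rewrite subr_ge0 => /(_ tu); lra.
have [c /andP[uc ct] e] := step u t u0 ut.
have := ler_wpM2r (_ : 0 <= t - u) (dprofile_le a0 uc).
rewrite subr_ge0 => /(_ ut); lra.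
Qed.

Lemma profileN (b t : R) : 0 <= b -> profile b (- t) = profile b t.
Proof. by move=> b0; rewrite -(profile_abs (- t))// normrN profile_abs. Qed.

Lemma profile_ge0 (b t : R) : 0 <= b -> 0 <= profile b t.
Proof.
move=> b0; have := profile_tangent t b0 (lexx 0).
by rewrite profile0// /dprofile ltxx mul0r addr0.
Qed.

End Profile.

(** * Gluing convex profiles over the eight sectors of the plane *)

Section Octant.
Variable R : realType.
Implicit Types (c r u v t x p : R) (g h k : R -> R).

(** The eight sectors are cut out by the axes and the diagonals.  On each of
them [M], [N] and [M + r N] are, up to sign, linear, and the sign is
irrelevant to even functions; in this form the symmetries of the bivariate
penalty are apparent. *)
Definition octant_glue r g h k (x1 x2 : R) :=
  let M := Num.max `|x1| `|x2| in let N := Num.min `|x1| `|x2| in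
  if 0 <= x1 * x2 then g (M + r * N) + (1 - r) * h N
  else g (M - r * N) + (1 + r) * k N.

(** Slopes are subgradients of even functions, for which the inequality at
[`|t|] is the natural one.  The constant [c] reflects [M + r N >= (1 + r) N]. *)
Definition steeper c g h := forall u v, 0 <= v -> c * v <= u ->
  exists m n : R, [/\ 0 <= n <= m,
    forall t, g u + m * (`|t| - u) <= g t &
    forall t, h v + n * (`|t| - v) <= h t].

Definition supported (P : R -> R -> R) (p1 p2 : R) := exists c1 c2,
  forall x1 x2, P p1 p2 + c1 * (x1 - p1) + c2 * (x2 - p2) <= P x1 x2.

Lemma octant_glueC r g h k (x1 x2 : R) :
  octant_glue r g h k x1 x2 = octant_glue r g h k x2 x1.
Proof. by rewrite /octant_glue mulrC maxC minC. Qed.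

Lemma octant_glueNN r g h k (x1 x2 : R) :
  octant_glue r g h k (- x1) (- x2) = octant_glue r g h k x1 x2.
Proof. by rewrite /octant_glue mulrNN !normrN. Qed.

Lemma octant_glue_ge0 r g h k (x1 x2 : R) : 0 <= x1 * x2 -> octant_glue r g h k x1 x2 =
  g (Num.max `|x1| `|x2| + r * Num.min `|x1| `|x2|) +
  (1 - r) * h (Num.min `|x1| `|x2|).
Proof. by rewrite /octant_glue => ->. Qed.

(** On the axes [N = 0] and both formulas agree. *)
Lemma octant_glue_le0 r g h k (x1 x2 : R) : h 0 = 0 -> k 0 = 0 -> x1 * x2 <= 0 ->
  octant_glue r g h k x1 x2 =
  g (Num.max `|x1| `|x2| - r * Num.min `|x1| `|x2|) +
  (1 + r) * k (Num.min `|x1| `|x2|).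
Proof.
move=> h0 k0; rewrite /octant_glue le_eqVlt => /orP[|x0]; last by rewrite leNgt x0.
move=> x0; rewrite (eqP x0) lexx; move: x0; rewrite mulf_eq0 => x0.
have -> : Num.min `|x1| `|x2| = 0.
  by case/orP: x0 => /eqP ->; rewrite normr0 ?[Num.min 0 _]min_l ?[Num.min _ 0]min_r.
by rewrite h0 k0 !mulr0 subr0 !addr0.
Qed.

Lemma octant_glue_reflect r g h k (x1 x2 : R) : h 0 = 0 -> k 0 = 0 ->
  octant_glue r g h k x1 (- x2) = octant_glue (- r) g k h x1 x2.
Proof.
move=> h0 k0; have [x0|/ltW x0] := leP 0 (x1 * x2).
  by rewrite octant_glue_le0 ?mulrN ?oppr_le0// octant_glue_ge0// normrN mulNr opprK.
by rewrite octant_glue_ge0 ?mulrN ?oppr_ge0// octant_glue_le0// normrN mulNr opprK.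
Qed.

(** Write the affine minorant as
[L x = m x1 + (r m + (1 - r) n) x2 - A - (1 - r) B], where [A] and [B] are the
values of the conjugates of [g] and [h] at [m] and [n].  Since [0 <= n <= m]
and [-1 <= r <= 1], the second coefficient is at most [m] in absolute value.  Hence, for
coordinates of equal sign and given [M] and [N], [L] is largest at
[x1 = M], [x2 = N], where it is the lower bound that the tangents of [g] and
[h] give.  When the signs differ, the tangent of [g] alone gives the lower
bound [m (M - r N) - A], which is enough. *)
Lemma octant_glue_supported_sector r g h k (p1 p2 : R) : -1 <= r <= 1 ->
  h 0 = 0 -> k 0 = 0 -> (forall t, 0 <= k t) -> steeper (1 + r) g h ->
  0 <= p2 <= p1 -> supported (octant_glue r g h k) p1 p2.
Proof.
move=> /andP[r1 r2] h0 k0 kge0 gh /andP[p20 p21].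
have p10 := le_trans p20 p21.
have [||m [n [/andP[n0 nm] gs hs]]] := gh (p1 + r * p2) p2; rewrite //; first by lra.
have m0 := le_trans n0 nm.
exists m, (r * m + (1 - r) * n) => x1 x2.
have -> : octant_glue r g h k p1 p2 = g (p1 + r * p2) + (1 - r) * h p2.
  by rewrite /octant_glue mulr_ge0// !ger0_norm// max_l// min_r.
(* [A] and [B] are the intercepts of the two tangents. *)
set A := m * (p1 + r * p2) - g (p1 + r * p2).
set B := n * p2 - h p2.
have gA t : m * `|t| - A <= g t by have := gs t; rewrite /A; lra.
have hB t : n * `|t| - B <= h t by have := hs t; rewrite /B; lra.
have B0 : 0 <= B by have := hB 0; rewrite normr0 h0; lra.
have q0 : 0 <= 1 - r by lra.
have q0' : 0 <= 1 + r by lra.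
have mr := mulr_ge0 m0 q0; have mr' := mulr_ge0 m0 q0'.
have nr := mulr_ge0 n0 q0.
have dr : 0 <= (m - n) * (1 - r) by apply: mulr_ge0 => //; lra.
have Br := mulr_ge0 q0 B0.
have -> : g (p1 + r * p2) + (1 - r) * h p2 + m * (x1 - p1)
   + (r * m + (1 - r) * n) * (x2 - p2)
  = m * x1 + (r * m + (1 - r) * n) * x2 - A - (1 - r) * B by rewrite /A /B; ring.
have same_sign M N : 0 <= N <= M -> m * M + (r * m + (1 - r) * n) * N
    - A - (1 - r) * B <= g (M + r * N) + (1 - r) * h N.
  move=> /andP[N0 NM].
  have := gA (M + r * N); have := ler_norm (M + r * N).
  have := hB N; rewrite ger0_norm//.
  move=> /(ler_wpM2l q0) + /(ler_wpM2l m0); lra.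
have opposite_sign M N : 0 <= N <= M ->
    m * (M - r * N) - A - (1 - r) * B <= g (M - r * N) + (1 + r) * k N.
  move=> /andP[N0 NM].
  have := gA (M - r * N); have := ler_norm (M - r * N).
  have := mulr_ge0 q0' (kge0 N).
  move=> + /(ler_wpM2l m0); lra.
set L := leLHS.
have max_min (y1 y2 : R) : 0 <= y1 -> 0 <= y2 -> exists M N,
    [/\ Num.max y1 y2 = M, Num.min y1 y2 = N, 0 <= N <= M &
     y1 = M /\ y2 = N \/ y1 = N /\ y2 = M].
  move=> y10 y20; case: leP => [|/ltW] h12; [exists y2, y1|exists y1, y2].
    by split=> //; [rewrite y10|right].
  by split=> //; [rewrite y20|left].
(* The products that the linear arithmetic below cannot find by itself. *)
have slopes (M N : R) : 0 <= N <= M ->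
  [/\ 0 <= m * (1 + r) * N, 0 <= m * (1 - r) * N,
       0 <= m * (1 + r) * (M - N) & 0 <= m * (1 - r) * (M - N)] /\
  [/\ 0 <= n * (1 - r) * N, 0 <= n * (1 - r) * (M - N),
       0 <= (m - n) * (1 - r) * N & 0 <= (m - n) * (1 - r) * (M - N)].
  by move=> /andP[N0 NM]; do 2!split; apply: mulr_ge0 => //; lra.
have [x10|/ltW x10] := leP 0 x1; have [x20|/ltW x20] := leP 0 x2.
- rewrite octant_glue_ge0 ?mulr_ge0// !ger0_norm//.
  have [M [N [-> -> NM MN]]] := max_min x1 x2 x10 x20.
  have := same_sign _ _ NM; have [[? ? ? ?] [? ? ? ?]] := slopes _ _ NM.
  case: MN => [][e1 e2]; rewrite /L e1 e2; lra.
- rewrite octant_glue_le0 ?mulr_ge0_le0// (ger0_norm x10) (ler0_norm x20).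
  have nx20 : 0 <= - x2 by rewrite oppr_ge0.
  have [M [N [-> -> NM MN]]] := max_min x1 (- x2) x10 nx20.
  have := opposite_sign _ _ NM; have [[? ? ? ?] [? ? ? ?]] := slopes _ _ NM.
  case: MN => [][e1 e2]; rewrite /L e1 -[x2]opprK e2; lra.
- rewrite octant_glue_le0 ?mulr_le0_ge0// (ger0_norm x20) (ler0_norm x10).
  have nx10 : 0 <= - x1 by rewrite oppr_ge0.
  have [M [N [-> -> NM MN]]] := max_min (- x1) x2 nx10 x20.
  have := opposite_sign _ _ NM; have [[? ? ? ?] [? ? ? ?]] := slopes _ _ NM.
  case: MN => [][e1 e2]; rewrite /L -[x1]opprK e1 e2; lra.
- rewrite octant_glue_ge0 ?mulr_le0// (ler0_norm x20) (ler0_norm x10).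
  have nx10 : 0 <= - x1 by rewrite oppr_ge0.
  have nx20 : 0 <= - x2 by rewrite oppr_ge0.
  have [M [N [-> -> NM MN]]] := max_min (- x1) (- x2) nx10 nx20.
  have := same_sign _ _ NM; have [[? ? ? ?] [? ? ? ?]] := slopes _ _ NM.
  case: MN => [][e1 e2]; rewrite /L -[x1]opprK e1 -[x2]opprK e2; lra.
Qed.

(** The symmetries bring [p] to the sector [0 <= p2 <= p1]; the reflection
[x2 -> - x2] exchanges [h] and [k] and changes the sign of [r], which is why
these are generalized with [p2]. *)
Lemma octant_glue_supported r g h k (p1 p2 : R) : -1 <= r <= 1 ->
  h 0 = 0 -> k 0 = 0 ->
  (forall t, 0 <= h t) -> (forall t, 0 <= k t) ->
  steeper (1 + r) g h -> steeper (1 - r) g k ->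
  supported (octant_glue r g h k) p1 p2.
Proof.
move=> r11 h0 k0 hge0 kge0 gh gk.
wlog p21 : p1 p2 / `|p2| <= `|p1|.
  move=> W; have [|/ltW p12] := leP `|p2| `|p1|; first exact: W.
  have [c1 [c2 E]] := W _ _ p12; exists c2, c1 => x1 x2.
  by rewrite [leRHS]octant_glueC; apply: le_trans (E _ _); rewrite octant_glueC; lra.
wlog p10 : p1 p2 p21 / 0 <= p1.
  move=> W; have [|/ltW p10] := leP 0 p1; first exact: W.
  have [| |c1 [c2 E]] := W (- p1) (- p2); rewrite ?normrN// ?oppr_ge0//.
  exists (- c1), (- c2) => x1 x2.
  rewrite -[leRHS]octant_glueNN; apply: le_trans (E _ _).
  by rewrite octant_glueNN; lra.
move: p21; rewrite (ger0_norm p10).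
wlog p20 : r h k p2 r11 h0 k0 hge0 kge0 gh gk / 0 <= p2.
  move=> W p21; have [p20|/ltW p20] := leP 0 p2; first exact: W.
  have [|||||||||c1 [c2 E]] := W (- r) k h (- p2); rewrite ?opprK ?normrN ?oppr_ge0//.
    by lra.
  exists c1, (- c2) => x1 x2.
  have refl z1 z2 : octant_glue r g h k z1 z2 = octant_glue (- r) g k h z1 (- z2).
    by rewrite octant_glue_reflect// opprK.
  by rewrite !refl; apply: le_trans (E _ _); lra.
rewrite (ger0_norm p20) => p21.
by apply: octant_glue_supported_sector; rewrite // p20.
Qed.

Lemma supported_convex (P : R -> R -> R) (s x1 x2 y1 y2 : R) :
  (forall p1 p2, supported P p1 p2) -> 0 <= s <= 1 ->
  P (s * x1 + (1 - s) * y1) (s * x2 + (1 - s) * y2) <=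
  s * P x1 x2 + (1 - s) * P y1 y2.
Proof.
move=> supP /andP[s0 s1].
have [c1 [c2 E]] := supP (s * x1 + (1 - s) * y1) (s * x2 + (1 - s) * y2).
have s1' : 0 <= 1 - s by lra.
have := lerD (ler_wpM2l s0 (E x1 x2)) (ler_wpM2l s1' (E y1 y2)).
apply: le_trans; rewrite le_eqVlt; apply/orP; left; apply/eqP; ring.
Qed.

Lemma octant_glue_A1 r g h k (x1 x2 : R) : (forall t, g (- t) = g t) ->
  (forall t, h (- t) = h t) -> 0 <= x2 * (x1 - x2) ->
  octant_glue r g h k x1 x2 = g (x1 + r * x2) + (1 - r) * h x2.
Proof.
move=> gN hN.
wlog x20 : x1 x2 / 0 <= x2.
  move=> W x12; have [|/ltW x20] := leP 0 x2; first by move/W; exact.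
  rewrite -octant_glueNN W ?oppr_ge0//; last by rewrite mulNr -mulrN opprD !opprK.
  by rewrite hN -gN; congr (g _ + _); ring.
have [-> _|x2N0] := eqVneq x2 0.
  rewrite octant_glue_ge0 ?mulr0// normr0 max_l// min_r// !mulr0 !addr0.
  by have [_|_] := ger0P x1; rewrite ?gN.
rewrite pmulr_rge0 ?subr_ge0 ?lt0r ?x2N0// => x21.
have x10 := le_trans x20 x21.
by rewrite octant_glue_ge0 ?mulr_ge0// !ger0_norm// max_l// min_r.
Qed.

Lemma octant_glue_A4 r g h k (x1 x2 : R) :
  (forall t, g (- t) = g t) -> (forall t, k (- t) = k t) ->
  h 0 = 0 -> k 0 = 0 -> x2 * (x1 + x2) <= 0 ->
  octant_glue r g h k x1 x2 = g (x1 + r * x2) + (1 + r) * k x2.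
Proof.
move=> gN kN h0 k0 x12; rewrite -[in LHS](opprK x2) octant_glue_reflect//.
rewrite octant_glue_A1//; last by rewrite opprK mulNr oppr_ge0.
by rewrite mulrNN opprK kN.
Qed.

Lemma octant_glue_A2 r g h k (x1 x2 : R) :
  (forall t, g (- t) = g t) -> (forall t, h (- t) = h t) ->
  x1 * (x1 - x2) <= 0 ->
  octant_glue r g h k x1 x2 = g (r * x1 + x2) + (1 - r) * h x1.
Proof.
move=> gN hN x12; rewrite octant_glueC octant_glue_A1//; first by rewrite [x2 + _]addrC.
by rewrite -opprB mulrN oppr_ge0.
Qed.

Lemma octant_glue_A3 r g h k (x1 x2 : R) :
  (forall t, g (- t) = g t) -> (forall t, k (- t) = k t) ->
  h 0 = 0 -> k 0 = 0 -> x1 * (x1 + x2) <= 0 ->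
  octant_glue r g h k x1 x2 = g (r * x1 + x2) + (1 + r) * k x1.
Proof.
move=> gN kN h0 k0 x12; rewrite octant_glueC octant_glue_A4//.
  by rewrite [x2 + _]addrC.
by rewrite [x2 + _]addrC.
Qed.

End Octant.

(** * The bivariate penalty as a glued function *)

Section BivariatePenalty.
Variables (R : realType) (phi : R -> R -> R).
Hypothesis phiP : univariate_penalty phi.

(** P10 turns the tangent of [profile b] at [c * v] into a tangent of
[profile (c * b)] at [v] with the same slope, and slopes of [profile b] grow
with the point.  When [c * b = 0] the second profile is constant, by P4. *)
Lemma profile_steeper (c b : R) : 0 <= c -> 0 <= b ->
  steeper c (profile phi b) (profile phi (c * b)).
Proof.
move=> c0 b0 u v v0 cvu.
have cv0 := mulr_ge0 c0 v0.
have [cb0|cbN0] := eqVneq (c * b) 0.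
  exists (dprofile phi b u), 0; split.
  - by rewrite lexx dprofile_ge0.
  - by move=> t; apply: profile_tangent => //; exact: le_trans cvu.
  - by move=> t; rewrite cb0 !profile_param0// mul0r addr0.
have [c0' b0'] : 0 < c /\ 0 < b.
  by move: cbN0; rewrite mulf_eq0 negb_or !lt0r c0 b0 !andbT => /andP[].
have scaleE t : profile phi (c * b) t = c^-1 * profile phi b (c * t).
  rewrite (profile_scale phiP (b := b)) ?mulr_gt0//; congr (_ * profile _ _ _).
    by field; rewrite !gt_eqF.
  by field; rewrite !gt_eqF.
exists (dprofile phi b u), (dprofile phi b (c * v)); split.
- by rewrite dprofile_ge0//= dprofile_le.
- by move=> t; apply: profile_tangent => //; exact: le_trans cvu.
- move=> t; rewrite !scaleE.
  have := profile_tangent phiP (c * t) b0 cv0.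
  rewrite normrM (ger0_norm c0) => E.
  rewrite ler_pdivlMl//; apply: le_trans E.
  rewrite mulrDr mulVKf ?gt_eqF// le_eqVlt; apply/orP; left; apply/eqP; ring.
Qed.


(** If all four tests failed, then [(x1 (x1 - x2)) (x2 (x1 + x2))] and
[(x1 (x1 + x2)) (x2 (x2 - x1))] would both be positive, but they are
opposite. *)
Lemma regions_cover (x1 x2 : R) :
  regionA1 x1 x2 = false -> regionA2 x1 x2 = false ->
  regionA3 x1 x2 = false -> regionA4 x1 x2.
Proof.
rewrite /regionA1 /regionA2 /regionA3 /regionA4.
move=> /negbT + /negbT + /negbT; rewrite -!ltNge => A1 A2 A3.
rewrite leNgt; apply/negP => A4.
have A1' : 0 < x2 * (x2 - x1) by lra.
have := mulr_gt0 A2 A4; have := mulr_gt0 A3 A1'; lra.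
Qed.

(** Division by zero gives [r = 0] when [a1 = a2 = 0], so the relations survive
in this case. *)
Lemma mean_ratio_spec (a1 a2 : R) : 0 <= a1 -> 0 <= a2 ->
  let al := (a1 + a2) / 2 in let r := (a1 - a2) / (a1 + a2) in
  [/\ 0 <= al, -1 <= r <= 1, a1 = (1 + r) * al & a2 = (1 - r) * al].
Proof.
move=> a10 a20 al r; have al0 : 0 <= al by rewrite divr_ge0 ?addr_ge0.
have [a0|aN0] := eqVneq (a1 + a2) 0.
  have [-> ->] : a1 = 0 /\ a2 = 0 by split; lra.
  by rewrite /al /r a0 invr0 !mulr0 !mul0r !mulr0 lerN10 ler01.
have a_gt0 : 0 < a1 + a2 by rewrite lt0r aN0 addr_ge0.
split=> //; rewrite /al /r; [|by field|by field].
by rewrite ler_pdivlMr// ler_pdivrMr//; apply/andP; split; lra.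
Qed.

Definition glued_penalty (a1 a2 : R) : R -> R -> R :=
  let al := (a1 + a2) / 2 in let r := (a1 - a2) / (a1 + a2) in
  octant_glue r (profile phi al) (profile phi a1) (profile phi a2).

Lemma glued_penalty_supported (a1 a2 p1 p2 : R) : 0 <= a1 -> 0 <= a2 ->
  supported (glued_penalty a1 a2) p1 p2.
Proof.
move=> a10 a20; have [al0 r_itv E1 E2] := mean_ratio_spec a10 a20.
have /andP[r1 r2] := r_itv.
apply: octant_glue_supported; rewrite ?profile0//.
- by move=> t; exact: profile_ge0.
- by move=> t; exact: profile_ge0.
- by rewrite [in X in steeper _ _ X]E1; apply: profile_steeper => //; lra.
- by rewrite [in X in steeper _ _ X]E2; apply: profile_steeper => //; lra.
Qed.

(** The quadratic is [alpha / 2 * (x1 ^+ 2 + x2 ^+ 2) + r * alpha * x1 * x2].  On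
[regionA1] it is also
[alpha / 2 * (x1 + r * x2) ^+ 2 + (1 - r) * (a1 / 2 * x2 ^+ 2)], which
completes both terms of [S] to profiles; likewise on the other regions. *)
Lemma bivariate_S_glue (a : 'rV[R]_2) (x : 'cV[R]_2) :
  let a1 : R := a 0 0 in let a2 : R := a 0 1 in
  let x1 : R := x 0 0 in let x2 : R := x 1 0 in
  0 <= a1 -> 0 <= a2 ->
  bivariate_S phi a x + a1 / 4 * (x1 + x2) ^+ 2 + a2 / 4 * (x1 - x2) ^+ 2 =
  glued_penalty a1 a2 x1 x2.
Proof.
move=> a1 a2 x1 x2 a10 a20; rewrite /glued_penalty.
set al : R := (a1 + a2) / 2; set r : R := (a1 - a2) / (a1 + a2).
have [al0 _ E1 E2] : [/\ 0 <= al, -1 <= r <= 1, a1 = (1 + r) * al &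
  a2 = (1 - r) * al] := mean_ratio_spec a10 a20.
have gN t := profileN phiP t al0.
have hN t := profileN phiP t a10.
have kN t := profileN phiP t a20.
have h0 := profile0 phiP a10; have k0 := profile0 phiP a20.
rewrite /bivariate_S -/a1 -/a2 -/x1 -/x2 -/al -/r.
(* With [a = 0] all profiles vanish, as does [S] by definition. *)
case: ifPn => [/eqP a0|_].
  have a1z : a1 = 0 by rewrite /a1 a0 mxE.
  have a2z : a2 = 0 by rewrite /a2 a0 mxE.
  have alz : al = 0 by rewrite /al a1z a2z addr0 mul0r.
  rewrite alz a1z a2z /octant_glue !profile_param0// !mul0r !mulr0 !addr0.
  by rewrite if_same.
clearbody r al a1 a2 x1 x2.
case: ifPn => [A|/negbTE A1]; first by rewrite octant_glue_A1// /profile E1 E2; field.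
case: ifPn => [A|/negbTE A2]; first by rewrite octant_glue_A2// /profile E1 E2; field.
case: ifPn => [A|/negbTE A3]; first by rewrite octant_glue_A3// /profile E1 E2; field.
have A := regions_cover A1 A2 A3; rewrite A.
by rewrite octant_glue_A4// /profile E1 E2; field.
Qed.

End BivariatePenalty.

(** * The quadratic data term *)

(** [Q d] is [(d1 + d2, d1 - d2) / sqrt 2], so [H^T *m H] acts on [d] as the
quadratic form on the right. *)
Lemma sqr_norm_mulmx_coords (R : realType) (H : 'M[R]_2) (gamma : 'rV[R]_2) :
  H^T *m H = (Qmx R)^T *m diag_mx gamma *m Qmx R ->
  forall d1 d2, (H 0 0 * d1 + H 0 1 * d2) ^+ 2 + (H 1 0 * d1 + H 1 1 * d2) ^+ 2 =
   gamma 0 0 / 2 * (d1 + d2) ^+ 2 + gamma 0 1 / 2 * (d1 - d2) ^+ 2.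
Proof.
move=> HTH d1 d2.
have q2 : (Num.sqrt 2)^-1 * (Num.sqrt 2)^-1 = 2^-1 :> R.
  by rewrite -invfM -expr2 sqr_sqrtr.
have E i j : H 0 i * H 0 j + H 1 i * H 1 j =
    (gamma 0 0 + (-1) ^+ i * (-1) ^+ j * gamma 0 1) / 2.
  have := congr1 (fun M : 'M[R]_2 => M i j) HTH.
  rewrite !mxE !big_ord_recl !big_ord0 !mxE.
  rewrite !big_ord_recl !big_ord0 !mxE/=.
  have -> : lift ord0 ord0 = 1 :> 'I_2 by apply: val_inj.
  rewrite -[ord0]/(0 : 'I_2) /bump/= !mul0n !mul1n !addr0 !mulr1n !mulr0n => ->.
  by rewrite -q2; ring.
have := E 0 0; have := E 0 1; have := E 1 1; rewrite /= !expr0 !expr1.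
move=> E11 E01 E00.
transitivity ((H 0 0 * H 0 0 + H 1 0 * H 1 0) * d1 ^+ 2 +
  (H 0 0 * H 0 1 + H 1 0 * H 1 1) * (2 * d1 * d2) +
  (H 0 1 * H 0 1 + H 1 1 * H 1 1) * d2 ^+ 2); first by ring.
by rewrite E00 E01 E11; field.
Qed.


(** The Jensen gap of the difference is [s * (1 - s)] times
[(g1 - c1) / 4 * (d1 + d2) ^+ 2 + (g2 - c2) / 4 * (d1 - d2) ^+ 2], where [d1]
and [d2] are the coordinates of the difference of the two points. *)
Lemma quadratic_convex (R : realFieldType) (h00 h01 h10 h11 y1 y2 g1 g2 c1 c2 : R)
    (q := fun x1 x2 : R =>
      2^-1 * ((y1 - (h00 * x1 + h01 * x2)) ^+ 2 +
              (y2 - (h10 * x1 + h11 * x2)) ^+ 2) -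
      (c1 / 4 * (x1 + x2) ^+ 2 + c2 / 4 * (x1 - x2) ^+ 2)) :
  (forall d1 d2, (h00 * d1 + h01 * d2) ^+ 2 + (h10 * d1 + h11 * d2) ^+ 2 =
    g1 / 2 * (d1 + d2) ^+ 2 + g2 / 2 * (d1 - d2) ^+ 2) ->
  c1 <= g1 -> c2 <= g2 ->
  forall s x1 x2 z1 z2 : R, 0 <= s <= 1 ->
  q (s * x1 + (1 - s) * z1) (s * x2 + (1 - s) * z2) <=
  s * q x1 x2 + (1 - s) * q z1 z2.
Proof.
move=> normE cg1 cg2 s x1 x2 z1 z2 /andP[s0 s1]; rewrite -subr_ge0.
have gapE : s * q x1 x2 + (1 - s) * q z1 z2 -
    q (s * x1 + (1 - s) * z1) (s * x2 + (1 - s) * z2) =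
  s * (1 - s) * ((g1 - c1) / 4 * ((x1 - z1) + (x2 - z2)) ^+ 2 +
                 (g2 - c2) / 4 * ((x1 - z1) - (x2 - z2)) ^+ 2).
  transitivity (s * (1 - s) *
    (2^-1 * ((h00 * (x1 - z1) + h01 * (x2 - z2)) ^+ 2 +
             (h10 * (x1 - z1) + h11 * (x2 - z2)) ^+ 2) -
     (c1 / 4 * ((x1 - z1) + (x2 - z2)) ^+ 2 +
      c2 / 4 * ((x1 - z1) - (x2 - z2)) ^+ 2))); first by rewrite /q; field.
  by rewrite normE; field.
rewrite gapE; apply: mulr_ge0; first by apply: mulr_ge0; lra.
by apply: addr_ge0; apply: mulr_ge0; rewrite ?sqr_ge0//; lra.
Qed.

Lemma objectiveE (R : realType) (phi : R -> R -> R) (lambda : R)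
    (y : 'cV[R]_2) (H : 'M[R]_2) (a : 'rV[R]_2) (x : 'cV[R]_2) :
  univariate_penalty phi -> 0 <= a 0 0 -> 0 <= a 0 1 ->
  objective phi H y lambda a x =
  2^-1 * ((y 0 0 - (H 0 0 * x 0 0 + H 0 1 * x 1 0)) ^+ 2 +
          (y 1 0 - (H 1 0 * x 0 0 + H 1 1 * x 1 0)) ^+ 2) -
  (lambda * a 0 0 / 4 * (x 0 0 + x 1 0) ^+ 2 +
   lambda * a 0 1 / 4 * (x 0 0 - x 1 0) ^+ 2) +
  lambda * (glued_penalty phi (a 0 0) (a 0 1) (x 0 0) (x 1 0) +
            (`|x 0 0| + `|x 1 0|)).
Proof.
move=> phiP a10 a20; rewrite -bivariate_S_glue//.
rewrite /objective /bivariate_penalty /l2_norm /l1_norm.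
rewrite sqr_sqrtr; last by apply: sumr_ge0 => i _; exact: sqr_ge0.
rewrite !big_ord_recl !big_ord0 !mxE !big_ord_recl !big_ord0 !addr0.
have -> : lift ord0 ord0 = 1 :> 'I_2 by apply: val_inj.
by rewrite -[ord0]/(0 : 'I_2); field.
Qed.

Lemma norm_convex (R : realDomainType) (s x z : R) : 0 <= s <= 1 ->
  `|s * x + (1 - s) * z| <= s * `|x| + (1 - s) * `|z|.
Proof.
move=> /andP[s0 s1]; apply: le_trans (ler_normD _ _) _.
by rewrite !normrM (ger0_norm s0) [`|1 - s|]ger0_norm// subr_ge0.
Qed.

Theorem theorem2 (R : realType) (phi : R -> R -> R) (lambda : R)
    (y : 'cV[R]_2) (H : 'M[R]_2) (gamma a : 'rV[R]_2)
    (phi_penalty : univariate_penalty phi)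
    (lambda_gt0 : 0 < lambda)
    (HTH : H^T *m H = (Qmx R)^T *m diag_mx gamma *m Qmx R)
    (a_bounds : forall i : 'I_2, 0 <= a 0 i <= gamma 0 i / lambda) :
  @convex_function R 'cV[R]_2 [set: 'cV[R]_2] (objective phi H y lambda a).
Proof.
move=> t x z _ _.
have /andP[a10] := a_bounds 0; rewrite ler_pdivlMr// mulrC => a1g.
have /andP[a20] := a_bounds 1; rewrite ler_pdivlMr// mulrC => a2g.
have s01 : 0 <= t%:num <= 1 by rewrite ge0 le1.
have -> : conv t x z = t%:num *: (x : 'cV[R]_2) + (1 - t%:num) *: (z : 'cV[R]_2).
  by [].
rewrite convRE !objectiveE// !mxE.
move: (t%:num) s01 => s s01.
have := quadratic_convex (y 0 0) (y 1 0) (sqr_norm_mulmx_coords HTH) a1g a2g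
  (x 0 0) (x 1 0) (z 0 0) (z 1 0) s01.
have := supported_convex (x 0 0) (x 1 0) (z 0 0) (z 1 0)
  (fun p1 p2 => glued_penalty_supported phi_penalty p1 p2 a10 a20) s01.
have := norm_convex (x 0 0) (z 0 0) s01; have := norm_convex (x 1 0) (z 1 0) s01.
move=> n1 n2 gl; have := ler_wpM2l (ltW lambda_gt0) (lerD gl (lerD n2 n1)).
move=> + qc => /(lerD qc)/le_trans; apply.
rewrite -[unstable.onem s]/(1 - s).
by rewrite le_eqVlt; apply/orP; left; apply/eqP; ring.
Qed.
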